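(* Let $n\ge 1$ and $0\le k\le n$ be integers. There is a constant $c$ depending only on $n$ such that for every integer $d\ge 1$ and every real $B\ge 1$, any $d$ $k$-planes in $\mathbb{P}^n_{\mathbb{Q}}$ jointly contain no more than $$c\,d^{\frac{n}{n+1}}B^{k+1}$$ rational points of height $\le B$.
   Context: A $k$-plane in $\mathbb{P}^n_{\mathbb{Q}}$ is a $k$-dimensional linear subvariety (defined over $\mathbb{Q}$). A rational point of $\mathbb{P}^n$ has height $\le B$ if it can be written in homogeneous integer coordinates $(x_0,\dots,x_n)$ (not all zero) with $|x_0|,\dots,|x_n|\le B$. *)

(* Defs.v *)
(* MathComp / MathComp-Analysis. *)
From HB Require Import structures.
From mathcomp Require Import all_boot all_order all_algebra.
From mathcomp Require Import all_classical all_reals all_analysis.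

Set Implicit Arguments.
Unset Strict Implicit.
Unset Printing Implicit Defensive.

Import Order.TTheory GRing.Theory Num.Theory.

Local Open Scope ring_scope.
Local Open Scope classical_set_scope.

(* A k-dimensional linear subvariety of P^n over Q is the projectivization of
   a (k+1)-dimensional linear subspace of Q^(n+1). *)
Definition kplane (n k : nat) : Type :=
  {V : {vspace 'rV[rat]_n.+1} | \dim V == k.+1}.

(* A rational point of P^n is a line through the origin in Q^(n+1). *)
Definition proj_point (n : nat) : Type :=
  {L : {vspace 'rV[rat]_n.+1} | \dim L == 1%N}.

HB.instance Definition _ (n : nat) := Choice.on (proj_point n).

Definition on_plane (n k : nat) (P : kplane n k) (p : proj_point n) : Prop :=
  (val p <= val P)%VS.

Definition homogeneous_coords (n : nat) (p : proj_point n)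
    (x : 'rV[int]_n.+1) : Prop :=
  x != 0 /\ val p = <[map_mx (intr : int -> rat) x]>%VS.

Definition height_le (R : realType) (n : nat) (p : proj_point n) (B : R) : Prop :=
  exists2 x : 'rV[int]_n.+1,
    homogeneous_coords p x & forall i, `|x 0 i|%:~R <= B.

Definition points_on_planes (R : realType) (n k d : nat)
    (P : 'I_d -> kplane n k) (B : R) : set (proj_point n) :=
  [set p | height_le p B /\ exists i, on_plane (P i) p].

(* Main.v *)
Require Import Defs.
From HB Require Import structures.
From mathcomp Require Import all_boot all_order all_algebra.
From mathcomp Require Import finmap.
From mathcomp Require Import all_classical all_reals all_analysis.
From mathcomp Require Import zify ring lra.

Import Order.TTheory GRing.Theory Num.Theory.

(** Put N = n + 1 and let N_V(r) be the number of integer vectors of sup norm at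
most r in a subspace V of Q^N. Round B up to a power 2^b. A plane may be replaced
by the span of its integer vectors of norm at most 2^b, which keeps those vectors
and does not raise the dimension; so only subspaces spanned by short integer
vectors occur.

Such a V of dimension m is built one line at a time, V = V' + <v>, where v has
norm at most 2^l and every integer point of V of norm at most 2^(l-1) already
lies in V'. The exponents l are dyadic successive minima of the lattice of
integer points of V, and their sum h (2^h is comparable with the height of V)
governs two counts. One is the number of points,
    N_V(2^b) ~ 2^(bm - h)   for b >= l                       (tower_upper, tower_lower);
the other is the number of subspaces,
    #{V of dimension m with exponent sum h} <= D 2^(hN)                    (tower_count).
For the second, V is determined by V' and by v modulo V'. Different V use
disjoint translates by v of the points of V' in the box of radius 2^l, all inside
the box of twice that radius, so V' has at most about 2^(lN) / N_V'(2^l)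
extensions (fibre_count). The division by N_V'(2^l) is what makes the sum over the
exponents l geometric; the cruder bound 2^(lN) would cost logarithms.

The upper bound for N_V rests on a covering argument with the exact exponent
m: some m coordinates control all the others on V (dominating_coordinates), so
the points of V in a large box are sorted into cells of an m-dimensional grid.

For d subspaces of dimension at most k + 1, with 2^(eN) <= d < 2^((e+1)N), the
number of points is therefore O(2^(b(k+1))) times the sum of 2^(-h(V)). There are
O(2^(jN)) subspaces with h = j, which gives 2^(jn) for each j < e, and all the
others together contribute at most d 2^(-e). Both are O(2^(en)), that is
O(d^(n/N)) (sum_pts). *)

Set Implicit Arguments.
Unset Strict Implicit.
Unset Printing Implicit Defensive.

Local Open Scope ring_scope.

(** * Finite sums and sequences *)

Lemma leq_expn2r a b e : (a <= b)%N -> (a ^ e <= b ^ e)%N.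
Proof. by case: e => // e; rewrite leq_exp2r. Qed.

Lemma size_le_fibres (S T : eqType) (f : S -> T) (s : seq S) (K : nat) :
  (forall w, w \in map f s -> (count (fun x => f x == w) s <= K)%N) ->
  (size s <= size (undup (map f s)) * K)%N.
Proof.
move=> HK; set t := undup _.
have -> : size s = (\sum_(w <- t) count (fun x => f x == w) s)%N.
  transitivity (\sum_(x <- s) \sum_(w <- t) (f x == w))%N.
    rewrite -sum1_size big_seq [RHS]big_seq; apply: eq_bigr => x xs.
    have ft : f x \in t by rewrite mem_undup map_f.
    rewrite (bigD1_seq (f x)) ?undup_uniq //= eqxx big1 // => w.
    by rewrite eq_sym => /negbTE ->.
  rewrite exchange_big; apply: eq_bigr => w _.
  by rewrite -sum1_count [RHS]big_mkcond; apply: eq_bigr => x _; case: (f x == w).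
apply: (@leq_trans (\sum_(w <- t) K)%N); last first.
  by rewrite big_const_seq count_predT iter_addn_0 mulnC.
rewrite big_seq [leqRHS]big_seq; apply: leq_sum => w.
by rewrite mem_undup => /HK.
Qed.

(** The form in which the pigeonhole principle is used for lattice points: the
cells form a finite type, and only the size of one cell has to be estimated. *)
Lemma size_le_cells (S : eqType) (T : finType) (f : S -> T) (s : seq S) (K : nat) :
  (forall w, (count (fun x => f x == w) s <= K)%N) ->
  (size s <= #|T| * K)%N.
Proof.
move=> HK; apply: leq_trans (size_le_fibres (f := f) _) _; first by move=> w _; exact: HK.
rewrite leq_mul2r cardE uniq_leq_size ?undup_uniq ?orbT // => w _.
by rewrite mem_enum.
Qed.

Lemma size_le_inj (S T : eqType) (f : S -> T) (s : seq S) (t : seq T) :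
  uniq s -> {in s &, injective f} -> {in s, forall x, f x \in t} ->
  (size s <= size t)%N.
Proof.
move=> us fi ft; rewrite -(size_map f) uniq_leq_size ?map_inj_in_uniq //.
by move=> _ /mapP [x xs ->]; exact: ft.
Qed.

Lemma sum_by_level (T : eqType) (f a : T -> nat) (s : seq T) M :
  (forall x, x \in s -> (f x < M)%N) ->
  (\sum_(x <- s) a x = \sum_(l < M) \sum_(x <- [seq x <- s | f x == l]) a x)%N.
Proof.
move=> hs; under [RHS]eq_bigr do rewrite big_filter.
rewrite (exchange_big_dep xpredT) //= big_seq [RHS]big_seq.
by apply: eq_bigr => x /hs xM; rewrite (big_pred1 (Ordinal xM)).
Qed.

Lemma geometric_sum (g : nat -> nat) M X :
  (forall j, (j < M)%N -> (g j * 2 ^ j <= X)%N) -> (\sum_(j < M) g j <= 2 * X)%N.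
Proof.
elim: M g X => [|M IH] g X gX; first by rewrite big_ord0.
rewrite big_ord_recl /=.
have h0 : (g 0 <= X)%N by have := gX 0%N isT; rewrite muln1.
(* The terms after the first satisfy the hypothesis with X halved. *)
have h1 : (\sum_(j < M) g j.+1 <= 2 * (X %/ 2))%N.
  apply: (IH (fun j => g j.+1)) => j jM; rewrite leq_divRL // -mulnA -expnSr.
  exact: gX.
by move: h1; rewrite (eq_bigr (fun i : 'I_M => g i.+1)) //; lia.
Qed.

(** The terms live on l >= l0 and decay by a factor 2 from there on, with a bound
that does not involve l0: this absorbs the sum over the last dyadic minimum. *)
Lemma shifted_geometric_sum (g : nat -> nat) M l0 X :
  (forall l, (l < l0)%N -> g l = 0%N) ->
  (forall l, (l0 <= l)%N -> (g l * 2 ^ (l - l0) <= X)%N) ->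
  (\sum_(l < M) g l <= 2 * X)%N.
Proof.
move=> g0 gX; apply: (@leq_trans (\sum_(l < l0 + M) g l)%N).
  rewrite -!(big_mkord xpredT) [leqRHS](big_cat_nat (n := M)) ?leq_addl //=.
  exact: leq_addr.
rewrite big_split_ord /= big1 ?add0n => [|i _]; last exact: g0.
apply: (geometric_sum (g := fun j => g (l0 + j)%N)) => j _.
by have := gX _ (leq_addr j l0); rewrite addKn.
Qed.

(** * Coordinates dominating a subspace *)

Lemma det_replaced_col (F : fieldType) m (M : 'M[F]_m) (i : 'I_m) :
  (forall a b, b != i -> M a b = (a == b)%:R) -> \det M = M i i.
Proof.
move=> HM; rewrite (expand_det_row _ i) (bigD1 i) //= big1 ?addr0; last first.
  by move=> j ji; rewrite HM // eq_sym (negbTE ji) mul0r.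
rewrite /cofactor -signr_odd addnn odd_double expr0 mul1r.
suff -> : row' i (col' i M) = 1%:M by rewrite det1 mulr1.
apply/matrixP => a b; rewrite !mxE HM; last by rewrite eq_sym neq_lift.
by rewrite (inj_eq lift_inj).
Qed.

(** Take the columns of a maximal minor of largest absolute value. By Cramer's
rule each coefficient that expresses another column through them is a quotient of
two maximal minors, hence at most 1 in absolute value. *)
Lemma dominating_columns (m N : nat) (B : 'M[rat]_(m, N)) : row_free B ->
  exists f : 'I_m -> 'I_N, forall (c : 'rV_m) j,
    `|(c *m B) 0 j| <= \sum_(i < m) `|(c *m B) 0 (f i)|.
Proof.
move=> fB.
have fBT : row_full B^T by rewrite /row_full mxrank_tr.
pose f0 : {ffun 'I_m -> 'I_N} := fullrankfun fBT.
pose w (f : {ffun 'I_m -> 'I_N}) := `|\det (colsub f B)|.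
have w0 : w f0 != 0.
  by rewrite /w normr_eq0 -unitfE -unitmxE -unitmx_tr trmx_mxsub fullrowsub_unit.
case: (@Order.TotalTheory.arg_maxP _ _ _ f0 xpredT w isT) => f _ fmaxP.
have fmax g : w g <= w f by exact: fmaxP.
have wf : w f != 0.
  by apply: contraNneq w0 => wf; rewrite eq_le normr_ge0 andbT -wf fmax.
have uf : colsub f B \in unitmx by rewrite unitmxE unitfE -normr_eq0.
exists f => c j.
pose u := invmx (colsub f B) *m col j B.
have u1 i : `|u i 0| <= 1.
  pose g := [ffun k => if k == i then j else f k].
  have := fmax g; rewrite /w.
  have -> : colsub g B = colsub f B *m (invmx (colsub f B) *m colsub g B).
    by rewrite mulKVmx.
  rewrite det_mulmx normrM -[leRHS]mulr1 ler_pM2l; last by rewrite lt0r wf normr_ge0.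
  rewrite (@det_replaced_col _ _ _ i).
    congr (`|_| <= 1); rewrite /u !mxE; apply: eq_bigr => k _.
    by rewrite !mxE ffunE eqxx.
  move=> a b bi; have := mulVmx uf => /matrixP /(_ a b); rewrite [RHS]mxE => <-.
  rewrite !mxE; apply: eq_bigr => k _; rewrite !mxE ffunE (negbTE bi) //.
have -> : (c *m B) 0 j = \sum_i (c *m B) 0 (f i) * u i 0.
  have <- : (c *m B *m delta_mx j (0 : 'I_1)) 0 0 = (c *m B) 0 j.
    by rewrite -colE mxE.
  rewrite -mulmxA -colE.
  have -> : col j B = colsub f B *m u by rewrite /u mulKVmx.
  rewrite mulmxA mulmx_colsub [LHS]mxE; apply: eq_bigr => i _; by rewrite !mxE.
apply: le_trans (ler_norm_sum _ _ _) _; apply: ler_sum => i _.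
by rewrite normrM ler_piMr.
Qed.

(** No constant depending on V enters, so the lattice point counts that follow are
uniform in V. *)
Lemma dominating_coordinates (N : nat) (V : {vspace 'rV[rat]_N}) :
  exists f : 'I_(\dim V) -> 'I_N, forall x, x \in V -> forall j,
    `|x 0 j| <= \sum_i `|x 0 (f i)|.
Proof.
pose B : 'M[rat]_(\dim V, N) := \matrix_(i < \dim V) (vbasis V)`_i.
have mB (c : 'rV_(\dim V)) : c *m B = \sum_i c 0 i *: (vbasis V)`_i.
  by rewrite mulmx_sum_row; apply: eq_bigr => i _; rewrite rowK.
have fB : row_free B.
  apply/row_freeP; exists (\matrix_(j, i) (coord (vbasis V) i (delta_mx 0 j))).
  apply/row_matrixP => i; apply/rowP => j.
  rewrite row_mul rowK !mxE.
  transitivity (coord (vbasis V) j (vbasis V)`_i).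
    rewrite [in RHS](row_sum_delta (vbasis V)`_i) linear_sum /=.
    by apply: eq_bigr => k _; rewrite !mxE linearZ.
  by rewrite coord_free ?(basis_free (vbasisP V)).
have [f Hf] := dominating_columns fB; exists f => x xV j.
have -> : x = (\row_i coord (vbasis V) i x) *m B; last exact: Hf.
rewrite mB [LHS](coord_vbasis xV); by apply: eq_bigr => i _; rewrite !mxE.
Qed.

(** * Adding a line to a subspace *)

Lemma dim_add_line (vT : vectType rat) (V : {vspace vT}) v :
  v \notin V -> \dim (V + <[v]>) = (\dim V).+1.
Proof.
move=> vV; apply/eqP; rewrite eqn_leq; apply/andP; split.
  apply: leq_trans (dimv_add_leqif _ _) _.
  by rewrite dim_vline -addn1 leq_add2l; case: (_ != _).
rewrite ltn_neqAle dimvS ?addvSl // andbT.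
rewrite (dimv_leqif_eq (addvSl V <[v]>)).
apply: contra vV => /eqP ->; exact: subvP (addvSr _ _) _ (memv_line v).
Qed.

Lemma add_line_shift (vT : vectType rat) (V : {vspace vT}) v w :
  v - w \in V -> (V + <[v]> = V + <[w]>)%VS.
Proof.
have half (a b : vT) : a - b \in V -> (V + <[a]> <= V + <[b]>)%VS.
  move=> ab; rewrite subv_add addvSl -memvE -(subrK b a).
  by rewrite memv_add // memv_line.
move=> vw; apply: subv_anti; rewrite !half //.
by rewrite -memvN opprB.
Qed.

(** * Integer points of a subspace in a box *)

Section IntegerPoints.

Variable N : nat.
Implicit Types (V W U H : {vspace 'rV[rat]_N}) (x y v : 'rV[int]_N).

Definition ratv (x : 'rV[int]_N) : 'rV[rat]_N := map_mx (intr : int -> rat) x.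

Lemma ratvD x y : ratv (x + y) = ratv x + ratv y.
Proof. exact: map_mxD. Qed.

Lemma ratvB x y : ratv (x - y) = ratv x - ratv y.
Proof. exact: map_mxB. Qed.

Lemma ratv0 : ratv 0 = 0.
Proof. exact: map_mx0. Qed.

Lemma ratvMn x a : ratv (x *+ a) = a%:R *: ratv x.
Proof. by rewrite scaler_nat /ratv raddfMn. Qed.

Lemma ratv_inj : injective ratv.
Proof.
move=> x y /rowP h; apply/rowP => i; have := h i; rewrite !mxE => /eqP.
by rewrite eqr_int => /eqP.
Qed.

Definition box (r : nat) : seq 'rV[int]_N :=
  [seq \row_i ((y i : nat)%:Z - r%:Z) | y : {ffun 'I_N -> 'I_(2 * r).+1}].

Lemma mem_box r x : (x \in box r) = [forall i, (`|x 0%R i| <= r)%N].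
Proof.
apply/mapP/forallP => [[y _ ->] i | xr].
  by rewrite mxE; case: (y i) => p hp /=; lia.
exists [ffun i => inord `|(x 0 i + r%:Z)%R|%N]; first by rewrite mem_enum.
apply/rowP => i; have := xr i; rewrite mxE ffunE; move: (x 0 i) => p hp.
by rewrite inordK; lia.
Qed.

Lemma box_uniq r : uniq (box r).
Proof.
rewrite map_inj_uniq ?enum_uniq // => y z /rowP h; apply/ffunP => i.
by have := h i; rewrite !mxE => e; apply/val_inj => /=; lia.
Qed.

Lemma size_box r : size (box r) = ((2 * r).+1 ^ N)%N.
Proof. by rewrite size_map -cardE card_ffun !card_ord. Qed.

Lemma box0 r : 0 \in box r.
Proof. by rewrite mem_box; apply/forallP => i; rewrite mxE. Qed.

Lemma boxD r s x y : x \in box r -> y \in box s -> x + y \in box (r + s).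
Proof.
rewrite !mem_box => /forallP hx /forallP hy; apply/forallP => i.
by move: (hx i) (hy i); rewrite mxE; move: (x 0 i) (y 0 i) => p q; lia.
Qed.

Lemma boxMn r x a : x \in box r -> x *+ a \in box (a * r).
Proof.
move=> xr; elim: a => [|a IH]; first by rewrite mulr0n box0.
by rewrite mulrS mulSn boxD.
Qed.

Lemma box_mono r s x : (r <= s)%N -> x \in box r -> x \in box s.
Proof.
move=> rs; rewrite !mem_box => /forallP h; apply/forallP => i.
exact: leq_trans (h i) rs.
Qed.

Definition pts V r := [seq x <- box r | ratv x \in V].

Lemma mem_pts V r x : (x \in pts V r) = (ratv x \in V) && (x \in box r).
Proof. by rewrite mem_filter. Qed.

Lemma pts_uniq V r : uniq (pts V r).
Proof. by rewrite filter_uniq ?box_uniq. Qed.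

Lemma leq_pts V W r s :
  {subset pts V r <= pts W s} -> (size (pts V r) <= size (pts W s))%N.
Proof. by apply: uniq_leq_size; exact: pts_uniq. Qed.

Lemma size_pts_gt0 V r : (0 < size (pts V r))%N.
Proof.
by rewrite -has_predT; apply/hasP; exists 0; rewrite // mem_pts ratv0 mem0v box0.
Qed.

Lemma shift_le (p : int) r : (`|p| <= r)%N -> (`|(p + r%:Z)%R| <= 2 * r)%N.
Proof. lia. Qed.

Lemma same_quotient_close (p q : int) r t : (`|p| <= r)%N -> (`|q| <= r)%N ->
  (`|(p + r%:Z)%R| %/ t.+1 = `|(q + r%:Z)%R| %/ t.+1)%N -> (`|(p - q)%R| <= t)%N.
Proof.
move=> hp hq e.
have := divn_eq `|(p + r%:Z)%R|%N t.+1; have := divn_eq `|(q + r%:Z)%R|%N t.+1.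
have : (`|(p + r%:Z)%R| %% t.+1 < t.+1)%N by rewrite ltn_mod.
have : (`|(q + r%:Z)%R| %% t.+1 < t.+1)%N by rewrite ltn_mod.
by rewrite e; move: (_ * t.+1)%N (_ %% _)%N (_ %% _)%N => ???; lia.
Qed.

(** Sort the points of V of norm at most 2^b into cells by their dominating coordinates,
with a side proportional to 2^a. Two points of one cell differ by a point of V of
norm at most 2^a, so a cell has no more points than the smaller box. Cells that are
boxes in all N coordinates would give the exponent N instead of \dim V. *)
Lemma covering V a b : (a <= b)%N ->
  (size (pts V (2 ^ b)) <=
   (2 * (\dim V).+1) ^ \dim V * 2 ^ ((b - a) * \dim V) * size (pts V (2 ^ a)))%N.
Proof.
move=> ab; have [f Hf] := dominating_coordinates V.
set m := \dim V in f Hf *; set r := (2 ^ b)%N; set s := (2 ^ a)%N.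
(* With cells of side t, coordinates differ by at most s / (m + 1) within a cell;
   the quotient by m + 1 instead of m also covers m = 0. *)
pose t := (s %/ m.+1).+1.
have rs : r = (s * 2 ^ (b - a))%N by rewrite /r /s -expnD subnKC.
have tm : (m * t.-1 <= s)%N.
  by rewrite mulnC /=; apply: leq_trans (leq_trunc_div s m.+1); rewrite leq_mul2l leqnSn orbT.
pose cell (x : 'rV[int]_N) : {ffun 'I_m -> 'I_(2 * r %/ t).+1} :=
  [ffun i => inord (`|(x 0%R (f i) + r%:Z)%R| %/ t)%N].
have cells : (#|{: {ffun 'I_m -> 'I_(2 * r %/ t).+1}}|
    <= (2 * m.+1) ^ m * 2 ^ ((b - a) * m))%N.
  rewrite card_ffun !card_ord expnM -expnMn; apply: leq_expn2r.
  rewrite ltn_divLR // rs.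
  have st : (s < m.+1 * t)%N by rewrite mulnC ltn_ceil.
  have P0 : (0 < 2 ^ (b - a))%N by rewrite expn_gt0.
  by rewrite -[ltnRHS]mulnA [(_ * t)%N]mulnC [ltnRHS]mulnA -(mulnA 2 _ t) mulnA ltn_pmul2r // ltn_pmul2l.
apply: leq_trans (leq_mul cells (leqnn _)).
apply: (size_le_cells (f := cell)) => w.
rewrite -size_filter.
case Es : [seq x <- pts V r | cell x == w] => [//|y q]; rewrite -Es.
have : y \in [seq x <- pts V r | cell x == w] by rewrite Es mem_head.
rewrite mem_filter mem_pts mem_box => /and3P [/eqP cy yV /forallP yr].
apply: (@size_le_inj _ _ (fun x => x - y)); first by rewrite filter_uniq ?pts_uniq.
  by move=> x z _ _ /addIr.
move=> x; rewrite mem_filter mem_pts mem_box => /and3P [/eqP cx xV /forallP xr].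
have dV : ratv (x - y) \in V by rewrite ratvB memvB.
rewrite mem_pts dV /= mem_box; apply/forallP => j.
have close i : (`|(x - y)%R 0%R (f i)| <= t.-1)%N.
  have := congr1 (fun g : {ffun _ -> _} => val (g i)) (etrans cx (esym cy)).
  rewrite !ffunE /= !inordK ?ltnS; last 2 first.
  - exact: leq_div2r (shift_le (yr (f i))).
  - exact: leq_div2r (shift_le (xr (f i))).
  by rewrite !mxE; apply: same_quotient_close (xr (f i)) (yr (f i)).
have toN k : `|ratv (x - y) 0 k| = (`|(x - y)%R 0%R k|%N)%:R.
  by rewrite mxE -intr_norm -abszE.
have := Hf _ dV j; rewrite toN.
under eq_bigr do rewrite toN.
rewrite -natr_sum ler_nat => h; apply: leq_trans h (leq_trans _ tm).
by rewrite -[m in (m * _)%N]card_ord -sum_nat_const; apply: leq_sum => i _; exact: close.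
Qed.

Lemma ratv_sum_inj V v x y a c : ratv v \notin V ->
  ratv x \in V -> ratv y \in V -> v *+ a + x = v *+ c + y -> a = c /\ x = y.
Proof.
move=> vV xV yV e.
have ac : a = c.
  apply: contraNeq vV => ac.
  have e' : (a%:R - c%:R) *: ratv v = ratv y - ratv x.
    have := congr1 ratv e; rewrite !ratvD !ratvMn => h; apply/eqP.
    rewrite scalerBl subr_eq -(inj_eq (addIr (ratv x))) h addrAC subrK.
    by rewrite addrC.
  have nz : (a%:R - c%:R : rat) != 0 by rewrite subr_eq0 eqr_nat.
  by rewrite -(scalerK nz (ratv v)) e' memvZ ?memvB.
by split=> //; move: e; rewrite ac => /addrI.
Qed.

(** Choose for each W a generator modulo V. The translates of the points of V by
these generators are pairwise disjoint, because a common point would make two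
generators congruent modulo V and hence two W equal, and they all lie in the box of
radius 2 L. *)
Lemma fibre_count V L (s : seq {vspace 'rV[rat]_N}) : uniq s ->
  (forall W, W \in s -> exists2 v, v \in box L & W = (V + <[ratv v]>)%VS) ->
  (size s * size (pts V L) <= (2 * (2 * L)).+1 ^ N)%N.
Proof.
move=> us hs.
pose c W := nth 0 (box L) (find (fun v => W == V + <[ratv v]>)%VS (box L)).
have cP W : W \in s -> c W \in box L /\ W = (V + <[ratv (c W)]>)%VS.
  move=> /hs [v vL eW].
  have hv : has (fun v => W == V + <[ratv v]>)%VS (box L).
    by apply/hasP; exists v; rewrite // eW.
  by split; [rewrite mem_nth -?has_find | apply/eqP; exact: (nth_find 0 hv)].
rewrite -size_box -(size_allpairs (fun W x => c W + x)).
apply: uniq_leq_size.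
  apply: allpairs_uniq; rewrite ?pts_uniq //.
  move=> [W0 x0] [W1 y1] /allpairsP [[W x] [/= sW xV [-> ->]]] /allpairsP [[W' y] [/= sW' yV [-> ->]]] /= e.
  move: xV yV; rewrite !mem_pts => /andP[xV _] /andP[yV _].
  have WW : W = W'.
    rewrite (proj2 (cP _ sW)) (proj2 (cP _ sW')); apply: add_line_shift.
    have -> : c W = c W' + y - x by rewrite -e addrK.
    by rewrite ratvB ratvD (addrC (ratv (c W'))) addrAC addrK memvB.
  by move: e; rewrite WW => /addrI ->.
move=> _ /allpairsP [[W x] [/= /cP [cL _] + ->]].
by rewrite mem_pts => /andP[_ xL]; rewrite mul2n -addnn boxD.
Qed.

(** * Towers of short vectors *)

(** In tower m l h V the subspace V has dimension m, l is its last dyadic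
successive minimum and h is the sum of all of them. The last hypothesis of towerS
says that l is minimal; for l = 0 there is no smaller dyadic box, and minimality
is void. *)
Inductive tower : nat -> nat -> nat -> {vspace 'rV[rat]_N} -> Prop :=
| tower0 : tower 0 0 0 0%VS
| towerS m l' l h V v : tower m l' h V -> (l' <= l)%N ->
    v \in box (2 ^ l) -> ratv v \notin V ->
    ((0 < l)%N -> {subset pts (V + <[ratv v]>) (2 ^ l.-1) <= pts V (2 ^ l.-1)}) ->
    tower m.+1 l (l + h) (V + <[ratv v]>).

Lemma tower_dim m l h V : tower m l h V -> \dim V = m.
Proof.
by elim=> [|{l h V} m l' l h V v _ IH _ _ vV _]; rewrite ?dimv0 // dim_add_line ?IH.
Qed.

Lemma tower_height m l h V : tower m l h V -> (h <= m * l)%N.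
Proof. by elim=> // {l h V} m l' l h V v _ IH ll _ _ _; nia. Qed.

Lemma dim_le_ambient V : (\dim V <= N)%N.
Proof. by have := dimvS (subvf V); rewrite dimvf /dim /= mul1n. Qed.

(** The factors come from the number of cells in the covering, from the points of
norm at most 1, and from passing between the scales 2^(l-1) and 2^l. *)
Definition upper_const := ((2 * N.+1) ^ N * 3 ^ N * 2 ^ N)%N.

(** Cover the box of radius 2^b by boxes of radius 2^(l-1): there, by minimality
of l, the points of V lie in V', and induction applies to V' at the scale 2^l. If
l = 0 then all exponents vanish, and covering by boxes of radius 1 suffices. *)
Lemma tower_upper m l h V : tower m l h V -> forall b, (l <= b)%N ->
  (size (pts V (2 ^ b)) * 2 ^ h <= upper_const ^ m * 2 ^ (b * m))%N.
Proof.
elim=> [b _|{l h V} m l' l h V v tV IH ll vl vV gap b lb].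
  rewrite expn0 muln1 muln0 !expn0 muln1 -[leqRHS]/(size [:: 0 : 'rV[int]_N]).
  apply: uniq_leq_size; first exact: pts_uniq.
  by move=> x; rewrite mem_pts memv0 inE -(inj_eq ratv_inj) ratv0 => /andP[].
set W := (V + _)%VS in gap *.
have tW : tower m.+1 l (l + h) W by apply: towerS tV ll vl vV gap.
have dW : \dim W = m.+1 := tower_dim tW.
have mN : (m < N)%N by rewrite -dW dim_le_ambient.
have cov a : (a <= b)%N -> (size (pts W (2 ^ b)) <=
   (2 * N.+1) ^ N * 2 ^ ((b - a) * m.+1) * size (pts W (2 ^ a)))%N.
  move=> ab; apply: leq_trans (covering _ ab) _; rewrite dW !leq_mul2r.
  apply/orP; right; apply/orP; right.
  apply: (@leq_trans ((2 * N.+1) ^ m.+1)); first by apply: leq_expn2r; lia.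
  by rewrite leq_pexp2l.
have [l0|lpos] := posnP l.
  have h0 : h = 0%N by have := tower_height tV; lia.
  rewrite h0 l0 addn0 expn0 muln1; apply: leq_trans (cov 0%N isT) _.
  rewrite subn0 mulnAC leq_mul2r expn_eq0 /= expnS.
  apply: (@leq_trans upper_const); last by rewrite leq_pmulr // expn_gt0 !muln_gt0 !expn_gt0.
  rewrite /upper_const -!mulnA leq_mul2l; apply/orP; right.
  apply: (@leq_trans (3 ^ N)); last by rewrite leq_pmulr // expn_gt0.
  by rewrite /pts size_filter (leq_trans (count_size _ _)) // size_box expn0 muln1.
have h1 : (size (pts W (2 ^ l.-1)) <= size (pts V (2 ^ l)))%N.
  apply: leq_trans (leq_pts (gap lpos)) _; apply: leq_pts => x; rewrite !mem_pts.
  case/andP=> -> /= ; apply: box_mono; rewrite leq_exp2l //; lia.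
have h2 := IH l ll.
have h3 := cov l.-1 (leq_trans (leq_pred l) lb).
rewrite expnD mulnCA.
apply: leq_trans (leq_mul (leqnn _) (leq_mul h3 (leqnn _))) _.
have h4 := leq_trans (leq_mul h1 (leqnn _)) h2.
rewrite -[(_ * _ * 2 ^ h)%N]mulnA.
apply: leq_trans (leq_mul (leqnn _) (leq_mul (leqnn _) h4)) _.
have -> : (2 ^ l * ((2 * N.+1) ^ N * 2 ^ ((b - l.-1) * m.+1) * (upper_const ^ m * 2 ^ (l * m))) =
  upper_const ^ m * ((2 * N.+1) ^ N * 2 ^ m.+1) * 2 ^ (b * m.+1))%N.
  rewrite [LHS](_ : _ = (2 * N.+1) ^ N * upper_const ^ m * (2 ^ l * 2 ^ ((b - l.-1) * m.+1) * 2 ^ (l * m)))%N; last by ring.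
  rewrite -!expnD (_ : (l + _ + l * m)%N = (m.+1 + b * m.+1)%N); last by nia.
  by rewrite expnD; ring.
rewrite leq_mul2r (expnSr upper_const) leq_mul2l; apply/orP; right; apply/orP; right.
rewrite /upper_const -mulnA leq_mul2l; apply/orP; right.
apply: leq_trans (leq_pmull _ _); last by rewrite expn_gt0.
by rewrite leq_pexp2l.
Qed.

(** At the scale b = l the points of V' are already numerous enough. At the scale
b + 1 > l, the multiples a v with a < 2^(b-l) translate the points of V' of norm at
most 2^b into disjoint sets of points of V. *)
Lemma tower_lower m l h V : tower m l h V -> forall b, (l <= b)%N ->
  (2 ^ (b * m) <= 2 ^ (m * m) * (size (pts V (2 ^ b)) * 2 ^ h))%N.
Proof.
elim=> [b _|{l h V} m l' l h V v tV IH ll vl vV _ b].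
  by rewrite muln0 muln0 !expn0 mul1n muln1 size_pts_gt0.
set W := (V + _)%VS.
have VW : (V <= W)%VS by exact: addvSl.
have mono : (2 ^ (m * m) <= 2 ^ (m.+1 * m.+1))%N by rewrite leq_pexp2l // leq_mul.
rewrite leq_eqVlt => /predU1P [<-|lb].
  have hW : (size (pts V (2 ^ l)) <= size (pts W (2 ^ l)))%N.
    apply: leq_pts => x; rewrite !mem_pts => /andP[xV ->].
    by rewrite (subvP VW).
  rewrite mulnS !expnD [(_ * (2 ^ l * _))%N]mulnCA mulnCA leq_mul2l; apply/orP; right.
  apply: leq_trans (IH l ll) _.
  by rewrite leq_mul // leq_mul.
case: b lb => // b; rewrite ltnS => lb.
have hW : (2 ^ (b - l) * size (pts V (2 ^ b)) <= size (pts W (2 ^ b.+1)))%N.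
  rewrite -[X in (X * _)%N](size_iota 0) -(size_allpairs (fun a x => v *+ a + x)).
  apply: uniq_leq_size.
    apply: allpairs_uniq; rewrite ?iota_uniq ?pts_uniq //.
    move=> [a x] [c y] /allpairsP [[? ?] [_ /= xV [-> ->]]] /allpairsP [[? ?] [_ /= yV [-> ->]]] /=.
    move: xV yV; rewrite !mem_pts => /andP[xV _] /andP[yV _] e.
    by have [-> ->] := ratv_sum_inj vV xV yV e.
  move=> _ /allpairsP [[a x] [/= ha hx ->]]; move: ha hx.
  rewrite mem_iota add0n mem_pts => /andP[_ ha] /andP[xV xb].
  rewrite mem_pts ratvD ratvMn memvD ?(subvP VW _ xV) //=; last first.
    by rewrite memvZ // (subvP (addvSr _ _)) // memv_line.
  rewrite expnS mul2n -addnn; apply: boxD xb.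
  apply: box_mono (boxMn _ vl); rewrite -(subnK lb) expnD leq_mul2r.
  by rewrite ltnW ?orbT.
have h1 := IH b (leq_trans ll lb).
have -> : (2 ^ (b.+1 * m.+1) = 2 ^ m.+1 * (2 ^ (b - l) * 2 ^ l) * 2 ^ (b * m))%N.
  by rewrite -!expnD; congr (_ ^ _)%N; nia.
apply: leq_trans (leq_mul (leqnn _) h1) _.
apply: (@leq_trans (2 ^ m.+1 * 2 ^ (m * m) * ((2 ^ (b - l) * size (pts V (2 ^ b))) * 2 ^ (l + h)))%N).
  by rewrite expnD; apply: eq_leq; ring.
by rewrite -expnD leq_mul // ?leq_mul // leq_pexp2l //; nia.
Qed.

(** * Counting subspaces by their height *)

(** Sort the subspaces by the last exponent l and then by V'. There are
D 2^((h-l)N) choices of V', and each has at most about 2^(lN) / N_V'(2^l) extensions,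
where N_V'(2^l) is at least about 2^(lm - (h-l)). The product is
2^(hN) 2^(h - l(m+1)). Since h <= (m+1) l, this is a geometric series in l that
starts at a term of size 2^(hN). *)
Lemma tower_count m : exists D : nat, forall h (s : seq {vspace 'rV[rat]_N}),
  uniq s -> (forall V, V \in s -> exists l, tower m l h V) ->
  (size s <= D * 2 ^ (h * N))%N.
Proof.
elim: m => [|m [D IH]].
  exists 1%N => h s us hs; rewrite mul1n.
  apply: (@leq_trans 1%N); last by rewrite expn_gt0.
  rewrite -[1%N]/(size [:: 0%VS : {vspace 'rV[rat]_N}]); apply: uniq_leq_size => // V /hs [l].
  by rewrite inE => tV; have /eqP := tower_dim tV; rewrite dimv_eq0.
pose X0 := (D * 2 ^ (m * m) * 5 ^ N)%N.
exists (2 * X0)%N => h s us hs.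
have /choice [F FP] : forall V, exists p : nat * {vspace 'rV[rat]_N}, V \in s ->
    [/\ (h <= m.+1 * p.1)%N, (p.1 <= h)%N,
        exists2 l', (l' <= p.1)%N & tower m l' (h - p.1) p.2 &
        exists2 v, v \in box (2 ^ p.1) & V = (p.2 + <[ratv v]>)%VS].
  move=> V; have [Vs|] := boolP (V \in s); last by exists (0%N, V).
  have [l tV] := hs V Vs; have hh := tower_height tV.
  inversion tV; subst.
  exists (l, V0) => _; split => //=; first exact: leq_addr.
    by exists l' => //; rewrite addKn.
  by exists v.
(* The least l with h <= (m + 1) l. *)
pose l0 := ((h + m) %/ m.+1)%N.
have l0P : (h <= l0 * m.+1)%N.
  by have := divn_eq (h + m) m.+1; have := ltn_pmod (h + m) (ltn0Sn m); rewrite -/l0; nia.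
rewrite -sum1_size (@sum_by_level _ (fun V => (F V).1) _ s h.+1); last first.
  by move=> V /FP [_ ? _ _].
under eq_bigr do rewrite sum1_size.
rewrite -mulnA; apply: (@shifted_geometric_sum (fun l => size [seq V <- s | (F V).1 == l]) h.+1 l0).
  move=> l ll0; apply/eqP; rewrite size_eq0 -(negbK (_ == _)) -has_filter; apply/hasPn => V /FP [hV _ _ _].
  apply: contraL ll0 => /eqP <-; rewrite -leqNgt /l0 -ltnS ltn_divLR //; nia.
move=> l l0l; set sl := [seq V <- s | _].
have key : (size sl * 2 ^ (l * m.+1) <= X0 * 2 ^ (h * N) * 2 ^ h)%N.
  have [lh|hl] := leqP l h; last first.
    rewrite (_ : sl = [::]) //; apply/eqP; rewrite -(negbK (_ == _)) -has_filter; apply/hasPn => V /FP [_ lh _ _].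
    by apply: contraL hl => /eqP <-; rewrite -leqNgt.
  (* The bound for the number of extensions of one V', with tower_lower inserted. *)
  pose K := ((5 * 2 ^ l) ^ N * (2 ^ (m * m) * 2 ^ (h - l)) %/ 2 ^ (l * m))%N.
  have slP V : V \in sl -> V \in s /\ (F V).1 = l.
    by rewrite mem_filter => /andP[/eqP].
  have fib : (size sl <= size (undup (map (fun V => (F V).2) sl)) * K)%N.
    apply: size_le_fibres => w /mapP [V /slP [Vs Fl] ->]; rewrite -size_filter.
    have [_ _ [l' l'l tV] _] := FP V Vs; rewrite Fl in l'l tV.
    rewrite /K leq_divRL ?expn_gt0 //.
    apply: leq_trans (leq_mul (leqnn _) (tower_lower tV l'l)) _.
    set fb := [seq V <- sl | _].
    have fbP : (size fb * size (pts (F V).2 (2 ^ l)) <= (5 * 2 ^ l) ^ N)%N.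
      apply: leq_trans (fibre_count _ _) _.
      - by rewrite !filter_uniq.
      - move=> W; rewrite mem_filter => /andP[/eqP eW /slP [Ws Wl]].
        by have [_ _ _ [v]] := FP W Ws; rewrite eW Wl => ? ?; exists v.
      by apply: leq_expn2r; have : (0 < 2 ^ l)%N; [rewrite expn_gt0 | lia].
    apply: leq_trans (leq_mul fbP (leqnn _)).
    by apply: eq_leq; ring.
  have und : (size (undup (map (fun V => (F V).2) sl)) <= D * 2 ^ ((h - l) * N))%N.
    apply: IH; rewrite ?undup_uniq // => w; rewrite mem_undup => /mapP [V /slP [Vs Fl] ->].
    by have [_ _ [l' _ tV] _] := FP V Vs; rewrite Fl in tV; exists l'.
  have hK : (K * 2 ^ (l * m) <= (5 * 2 ^ l) ^ N * (2 ^ (m * m) * 2 ^ (h - l)))%N.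
    exact: leq_trunc_div.
  rewrite mulnS addnC expnD mulnA.
  apply: leq_trans (leq_mul (leq_mul fib (leqnn _)) (leqnn _)) _.
  rewrite -(mulnA _ K).
  apply: leq_trans (leq_mul (leq_mul und hK) (leqnn _)) _.
  rewrite expnMn -expnM /X0 -{4}(subnK lh) -[in (2 ^ (h * N))%N](subnK lh) mulnDl !expnD.
  by apply: eq_leq; ring.
have [hl|lh] := leqP h (l * m.+1).
  have hh : (l - l0 <= l * m.+1 - h)%N by nia.
  apply: (@leq_trans (size sl * 2 ^ (l * m.+1 - h))); first by rewrite leq_mul2l leq_pexp2l ?orbT.
  by rewrite -(@leq_pmul2r (2 ^ h)) ?expn_gt0 // -mulnA -expnD subnK.
by have := leq_mul l0l (leqnn m.+1); move: lh l0P; clearbody l0; lia.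
Qed.

Lemma size_le_by_dim (D : nat -> nat) h (s : seq {vspace 'rV[rat]_N}) :
  (forall m (t : seq {vspace 'rV[rat]_N}), uniq t ->
    (forall V, V \in t -> exists l, tower m l h V) -> (size t <= D m * 2 ^ (h * N))%N) ->
  uniq s -> (forall V, V \in s -> exists l, tower (\dim V) l h V) ->
  (size s <= (\sum_(m < N.+1) D m) * 2 ^ (h * N))%N.
Proof.
move=> HD us hs.
rewrite -sum1_size (@sum_by_level _ (fun V : {vspace 'rV[rat]_N} => \dim V) _ s N.+1); last first.
  by move=> V _; rewrite ltnS dim_le_ambient.
rewrite big_distrl /=; apply: leq_sum => m _; rewrite sum1_size.
apply: HD; first by rewrite filter_uniq.
by move=> V; rewrite mem_filter => /andP[/eqP <- /hs].
Qed.

(** * Subspaces spanned by short vectors carry towers *)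

Definition spanned r V := (V <= <<[seq ratv x | x <- pts V r]>>)%VS.

Lemma spanned_not_sub r V U : spanned r V -> ~~ (V <= U)%VS ->
  exists2 v, v \in pts V r & ratv v \notin U.
Proof.
move=> sV nVU; have [/allP h|/allPn [x xp xU]] := boolP (all (fun x => ratv x \in U) (pts V r)).
  case/negP: nVU; apply: subv_trans sV _; apply/span_subvP => _ /mapP [x xp ->]; exact: h.
by exists x.
Qed.

Lemma spanned_add r U v : spanned r U -> v \in box r -> spanned r (U + <[ratv v]>).
Proof.
move=> sU vr; rewrite /spanned subv_add; apply/andP; split.
  apply: subv_trans sU _; apply: sub_span => _ /mapP [x + ->].
  rewrite mem_pts => /andP[xU xr]; apply: map_f.
  by rewrite mem_pts xr (subvP (addvSl _ _)).
rewrite -memvE; apply: memv_span; apply: map_f.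
by rewrite mem_pts vr (subvP (addvSr _ _)) // memv_line.
Qed.

(** Add to U points of V outside of it, one at a time, until the codimension is 1. *)
Lemma spanned_hyperplane r V U m : \dim V = m.+1 -> spanned r V ->
  spanned r U -> (U <= V)%VS -> ~~ (V <= U)%VS ->
  exists H, [/\ (U <= H)%VS, (H <= V)%VS, \dim H = m & spanned r H].
Proof.
move=> dV sV; have [k] := ubnP (m - \dim U); elim: k U => // k IH U kU sU UV nVU.
have dUV : (\dim U <= m)%N.
  rewrite -ltnS -dV ltn_neqAle dimvS // andbT.
  by apply: contra nVU; rewrite (dimv_leqif_eq UV) => /eqP ->.
have [dU|dU] := eqVneq (\dim U) m; first by exists U; split.
have [v vp vU] := spanned_not_sub sV nVU.
move: vp; rewrite mem_pts => /andP[vV vr].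
have dU' := dim_add_line vU.
have UV' : (U + <[ratv v]> <= V)%VS by rewrite subv_add UV -memvE.
have [||||H [UH HV dH sH]] := IH (U + <[ratv v]>)%VS.
- by move: kU dU dUV; rewrite dU'; move: (\dim U) => z; lia.
- exact: spanned_add.
- exact: UV'.
- by apply/negP => /dimvS; rewrite dU' dV ltnS leqNgt ltn_neqAle dU dUV.
by exists H; split => //; apply: subv_trans UH; exact: addvSl.
Qed.

(** Take l minimal such that the points of V of norm at most 2^l span V. The
points of norm at most 2^(l-1) then span a proper subspace, which is contained in a
hyperplane H of V spanned by points of norm at most 2^l; H takes the place of V'. *)
Lemma tower_exists m V b : \dim V = m -> spanned (2 ^ b) V ->
  exists l h, (l <= b)%N /\ tower m l h V.
Proof.
elim: m V b => [|m IH] V b dV sV.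
  exists 0%N, 0%N; split=> //.
  have -> : V = 0%VS by apply/eqP; rewrite -dimv_eq0 dV.
  exact: tower0.
have exb : exists b, spanned (2 ^ b) V by exists b.
case: (ex_minnP exb) => l sl lmin.
(* For l = 0 the zero subspace serves as U, whatever vectors of norm 1 there are. *)
pose U := if l is l1.+1 then <<[seq ratv x | x <- pts V (2 ^ l1)]>>%VS else 0%VS.
have ptsU l1 x : l = l1.+1 -> x \in pts V (2 ^ l1) -> ratv x \in U.
  by move=> e xp; rewrite /U e; apply: memv_span; apply: map_f.
have UV : (U <= V)%VS.
  rewrite /U; case: (l) => [|l1]; first exact: sub0v.
  by apply/span_subvP => _ /mapP [x + ->]; rewrite mem_pts => /andP[].
have nVU : ~~ (V <= U)%VS.
  rewrite /U; case E : l => [|l1]; first by apply/negP => /dimvS; rewrite dimv0 dV.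
  by apply/negP => h; have := lmin l1 h; rewrite E ltnn.
have sU : spanned (2 ^ l) U.
  rewrite /U /spanned; case E : l => [|l1]; first exact: sub0v.
  apply: sub_span => _ /mapP [x xp ->]; apply: map_f.
  rewrite mem_pts memv_span ?map_f //=; move: xp; rewrite mem_pts => /andP[_].
  by apply: box_mono; rewrite leq_exp2l.
have [H [UH HV dH sH]] := spanned_hyperplane dV sl sU UV nVU.
have nVH : ~~ (V <= H)%VS by apply/negP => /dimvS; rewrite dV dH ltnn.
have [v vp vH] := spanned_not_sub sl nVH.
move: vp; rewrite mem_pts => /andP[vV vl].
have eV : V = (H + <[ratv v]>)%VS.
  apply/esym/eqP; rewrite eqEdim dim_add_line // dV dH leqnn andbT.
  by rewrite subv_add HV -memvE.
have [l' [h [l'l tH]]] := IH H l dH sH.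
exists l, (l + h)%N; split; first exact: lmin.
rewrite eV; apply: towerS tH l'l vl vH _ => l_gt0 x; rewrite -eV => xp.
rewrite mem_pts; move: (xp); rewrite mem_pts => /andP[_ ->]; rewrite andbT.
by apply: (subvP UH); apply: (ptsU l.-1) => //; rewrite prednK.
Qed.

End IntegerPoints.

(** * Points on a union of subspaces *)

(** Subspaces of height exponent j < e are estimated by their number 2^(jN), the
others by the number of all subspaces. Both are the single estimate D' 2^(jN) once
heights are truncated at e. *)
Lemma sum_pts (n : nat) : (1 <= n)%N -> exists c : nat,
  forall (k b e : nat) (s : seq {vspace 'rV[rat]_n.+1}), (k <= n)%N -> uniq s ->
  (size s < 2 ^ (e.+1 * n.+1))%N ->
  (forall V, V \in s -> (\dim V <= k.+1)%N /\ spanned (2 ^ b) V) ->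
  (\sum_(V <- s) size (pts V (2 ^ b)) <= c * 2 ^ (e * n) * 2 ^ (b * k.+1))%N.
Proof.
move=> n1; have /choice [D DP] := @tower_count n.+1.
pose D' := (\sum_(m < n.+2) D m + 2 ^ n.+1)%N.
exists (2 * (D' * upper_const n.+1 ^ n.+1))%N => k b e s kn us sd hs.
have /choice [h hP] : forall V : {vspace 'rV[rat]_n.+1}, exists h, V \in s ->
    exists2 l, (l <= b)%N & tower (\dim V) l h V.
  move=> V; have [Vs|] := boolP (V \in s); last by exists 0%N.
  have [l [h [lb tV]]] := tower_exists (erefl (\dim V)) (proj2 (hs V Vs)).
  by exists h => _; exists l.
pose C := (upper_const n.+1 ^ n.+1 * 2 ^ (b * k.+1))%N.
have K0 : (0 < upper_const n.+1)%N by rewrite /upper_const !muln_gt0 !expn_gt0.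
have aC V : V \in s -> (size (pts V (2 ^ b)) * 2 ^ h V <= C)%N.
  move=> Vs; have [l lb tV] := hP V Vs; have [dk _] := hs V Vs.
  apply: leq_trans (tower_upper tV lb) _; apply: leq_mul.
    by rewrite leq_pexp2l // (leq_trans dk).
  by rewrite leq_pexp2l // leq_mul2l dk orbT.
(* Truncation puts every V with h V >= e into the level e. *)
rewrite (@sum_by_level _ (fun V => minn (h V) e) _ s e.+1); last first.
  by move=> V _; rewrite ltnS geq_minr.
have level (j : 'I_e.+1) :
    (\sum_(V <- [seq V <- s | minn (h V) e == j]) size (pts V (2 ^ b)) <= D' * C * 2 ^ (j * n))%N.
  set sj := [seq V <- s | _].
  have sjs V : V \in sj -> V \in s by rewrite mem_filter => /andP[].
  have szj : (size sj <= D' * 2 ^ (j * n.+1))%N.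
    rewrite mulnDl; have [je|je] := eqVneq (j : nat) e.
      apply: leq_trans (leq_addl _ _); rewrite -expnD -mulSn je.
      by rewrite (leq_trans _ (ltnW sd)) // size_filter count_size.
    apply: leq_trans (leq_addr _ _); apply: size_le_by_dim.
    - by move=> m t ut ht; apply: DP.
    - by rewrite filter_uniq.
    move=> V; rewrite mem_filter => /andP[/eqP hj /hP [l _ tV]]; exists l.
    have hVj : h V = j by move: je hj; move: (h V) (nat_of_ord j) => p q; lia.
    by rewrite -hVj.
  rewrite -(@leq_pmul2r (2 ^ j)) ?expn_gt0 // big_distrl /=.
  apply: (@leq_trans (\sum_(V <- sj) C)).
    rewrite big_seq [leqRHS]big_seq; apply: leq_sum => V Vj.
    apply: leq_trans (aC V (sjs V Vj)); rewrite leq_mul2l leq_pexp2l ?orbT //.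
    by move: Vj; rewrite mem_filter => /andP[/eqP <- _]; rewrite geq_minl.
  rewrite big_const_seq count_predT iter_addn_0 mulnC.
  apply: leq_trans (leq_mul szj (leqnn _)) _.
  by rewrite mulnS expnD; apply: eq_leq; ring.
apply: (@leq_trans (\sum_(j < e.+1) D' * C * 2 ^ (j * n))%N).
  by apply: leq_sum => j _; exact: level.
rewrite -big_distrr /=.
(* Here n >= 1 makes the last term of the sum dominate. *)
have geo : (\sum_(j < e.+1) 2 ^ (j * n) <= 2 * 2 ^ (e * n))%N.
  elim: (e) => [|e' IH]; first by rewrite big_ord1 mul0n.
  rewrite big_ord_recr /=; apply: leq_trans (leq_add IH (leqnn _)) _.
  rewrite [leqRHS]mul2n -addnn leq_add2r -expnS leq_pexp2l // mulSn; lia.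
apply: leq_trans (leq_mul (leqnn _) geo) _.
by rewrite /C; apply: eq_leq; ring.
Qed.

(** * Projective points and real bounds *)

Lemma dyadic_bracket (R : realType) (B : R) : 1 <= B ->
  exists b : nat, B <= 2 ^+ b /\ 2 ^+ b <= 2 * B.
Proof.
move=> B1; have exb : exists b, B <= 2 ^+ b.
  exists (Num.bound B); apply: ltW; apply: lt_le_trans (archi_boundP _) _.
    by apply: le_trans B1.
  by rewrite -natrX ler_nat ltnW // ltn_expl.
case: (ex_minnP exb) => -[|b] Bb bmin.
  by exists 0%N; split => //; rewrite expr0; lra.
exists b.+1; split=> //; rewrite exprS ler_pM2l //; have [//|/ltW h] := lerP (2 ^+ b) B.
by have := bmin b h; rewrite ltnn.
Qed.

Lemma pow2_le_powR (R : realType) (n e d : nat) : (2 ^ (e * n.+1) <= d)%N ->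
  (2 ^ (e * n))%:R <= d%:R `^ (n%:R / n.+1%:R) :> R.
Proof.
move=> h.
have -> : (2 ^ (e * n))%:R = ((2 ^ (e * n.+1))%:R : R) `^ (n%:R / n.+1%:R).
  rewrite !expnM [in RHS]natrX -powR_mulrn ?ler0n // -powRrM mulrCA divff ?pnatr_eq0 //.
  by rewrite mulr1 powR_mulrn ?ler0n // natrX.
by rewrite ge0_ler_powR ?nnegrE ?ler0n ?divr_ge0 ?ler_nat.
Qed.

Local Open Scope classical_set_scope.

Lemma finite_card_le_size (T : choiceType) (A : set T) (s : seq T) :
  (forall x, A x -> x \in s) -> finite_set A /\ (#|` fset_set A| <= size s)%N.
Proof.
move=> As; have fA : finite_set A.
  by apply: sub_finite_set (finite_seq s) => x /As.
split=> //; apply: uniq_leq_size; first exact: fset_uniq.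
by move=> x xA; apply: As; move: xA; rewrite in_fset_set // inE.
Qed.

Theorem proposition3p2 (R : realType) (n : nat) (hn : (1 <= n)%N) :
  exists c : R, forall (k : nat), (k <= n)%N ->
    forall (d : nat), (1 <= d)%N -> forall (B : R), 1 <= B ->
    forall P : 'I_d -> kplane n k,
      finite_set (points_on_planes P B) /\
      (#|` fset_set (points_on_planes P B)|)%fset%:R
        <= c * (d%:R `^ (n%:R / n.+1%:R)) * B ^+ k.+1.
Proof.
have [c0 c0P] := sum_pts hn.
exists (c0 * 2 ^ n.+1)%:R => k kn d d1 B B1 P.
have [b [Bb bB]] := dyadic_bracket B1.
pose W i : {vspace 'rV[rat]_n.+1} :=
  <<[seq ratv x | x <- pts (val (P i)) (2 ^ b)]>>%VS.
have WP i : (W i <= val (P i))%VS.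
  by apply/span_subvP => _ /mapP [x + ->]; rewrite mem_pts => /andP[].
pose S := undup [seq W i | i : 'I_d].
have hS V : V \in S -> (\dim V <= k.+1)%N /\ spanned (2 ^ b) V.
  rewrite mem_undup => /mapP [i _ ->]; split.
    by apply: leq_trans (dimvS (WP i)) _; rewrite (eqP (valP (P i))).
  apply: sub_span => _ /mapP [x xp ->]; apply: map_f.
  by move: xp (xp); rewrite {1}mem_pts => /andP[_ xb] xp; rewrite mem_pts xb memv_span ?map_f.
(* 2^e is d^(1/(n+1)) up to a factor 2. *)
pose e := trunc_log (2 ^ n.+1) d.
have one2 : (1 < 2 ^ n.+1)%N by rewrite -[1%N](expn0 2) ltn_exp2l.
have /andP[de ed] : (2 ^ (e * n.+1) <= d < 2 ^ (e.+1 * n.+1))%N.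
  by rewrite ![(_ * n.+1)%N]mulnC !expnM; exact: trunc_log_bounds.
pose line (x : 'rV[int]_n.+1) : option (proj_point n) := insub <[ratv x]>%VS.
pose L := pmap line (flatten [seq pts V (2 ^ b) | V <- S]).
have [|fin card] := @finite_card_le_size _ (points_on_planes P B) L.
  move=> p [[x [x0 px] xB] [i pi]].
  rewrite mem_pmap; apply/mapP; exists x; last first.
    by rewrite /line -[X in insub X]px valK.
  apply/flattenP; exists (pts (W i) (2 ^ b)).
    by apply: map_f; rewrite mem_undup; apply: map_f; rewrite mem_enum.
  have xb : x \in box n.+1 (2 ^ b).
    rewrite mem_box; apply/forallP => j.
    have := le_trans (xB j) Bb; rewrite -abszE -natrX.
    by rewrite -pmulrn ler_nat.
  rewrite mem_pts xb andbT memv_span // map_f // mem_pts xb andbT.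
  by rewrite memvE; move: pi; rewrite /on_plane px.
split=> //.
apply: (@le_trans _ _ (c0 * 2 ^ (e * n) * 2 ^ (b * k.+1))%:R).
  rewrite ler_nat; apply: leq_trans card _.
  apply: leq_trans (c0P k b e S kn (undup_uniq _) _ hS).
    rewrite size_pmap (leq_trans (count_size _ _)) // size_flatten sumnE /shape.
    by rewrite !big_map.
  apply: leq_ltn_trans ed; apply: leq_trans (size_undup _) _.
  by rewrite size_map size_enum_ord.
rewrite !natrM -!mulrA ler_wpM2l ?ler0n // [leRHS]mulrCA ler_pM ?ler0n //.
  exact: pow2_le_powR.
rewrite expnM natrX [(2 ^ b)%:R]natrX.
apply: le_trans (lerXn2r _ _ _ bB) _; rewrite ?nnegrE ?exprn_ge0 ?mulr_ge0 ?ler0n //.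
  by apply: le_trans B1.
rewrite exprMn natrX ler_wpM2r ?exprn_ge0 //; first by apply: le_trans B1.
by rewrite ler_weXn2l ?ler1n.
Qed.
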